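(* Let $(G,S,T,k)$ be an instance of \textsc{Disjoint Subset-DFVS Compression} that has a shadowless solution. Let $F=\bigcup_{\emptyset\neq T_0\subseteq T}F_{T_0}$, where $F_{T_0}$ is defined below. Let $G^+$ be obtained from $G$ by adding a new vertex $t$ and an edge $(u,t)$ for every $u\in S^{-}$. Then there exists a solution $T'\subseteq V(G)\setminus T$ of the instance such that either $T'$ contains a vertex of $F\setminus T$, or $T'$ contains an important $T_0-(\{t\}\cup(T\setminus T_0))$ separator of $G^+$ for some non-empty $T_0\subseteq T$.
   Context: \textsc{Disjoint Subset-DFVS Compression}: an instance consists of a directed graph $G$, a set $S\subseteq E(G)$, a positive integer $k$ and a set $T\subseteq V(G)$ such that $G\setminus T$ has no $S$-closed-walk (a closed walk containing an edge of $S$); a solution is a set $T'\subseteq V(G)$ with $|T'|\le k$, $T'\cap T=\emptyset$, such that $G\setminus T'$ has no $S$-closed-walk. $S^-=\{u:(u,v)\in S\}$. For disjoint nonempty vertex sets $A,B$ of a digraph $H$, an $A-B$ separator is a set $W\subseteq V(H)\setminus(A\cup B)$ such that $H\setminus W$ has no path from $A$ to $B$; it is minimal if no proper subset is an $A-B$ separator; a minimal $A-B$ separator $W$ is important if there is no $A-B$ separator $W'$ with $|W'|\le |W|$ and $R^+_{H\setminus W}(A)\subsetneq R^+_{H\setminus W'}(A)$, where $R^+_{H'}(A)$ denotes the set of vertices reachable from $A$ in $H'$. The forward (resp. reverse) shadow of $T'$ with respect to $T$ is the set of vertices $v$ such that $T'$ is a $T-\{v\}$ (resp. $\{v\}-T$)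 separator in $G$; $T'$ is shadowless if both shadows are empty. Definition of $F_{T_0}$ for non-empty $T_0\subseteq T$: build the digraph $G'_{T_0}$ with vertex set $\{v_{\mathrm{in}},v_{\mathrm{out}}:v\in V(G)\}\cup\{s,t'\}$ and edges: for each $(u,v)\in E(G)$, the edge $(u_{\mathrm{out}},v_{\mathrm{in}})$ if $(u,v)\in S$ and $(u_{\mathrm{out}},v_{\mathrm{out}})$ otherwise; for each $v\in V(G)$, edges $(v_{\mathrm{in}},v_{\mathrm{out}})$ and $(v_{\mathrm{in}},t')$; for each $v\in T_0$, the edge $(s,v_{\mathrm{out}})$. Then $F_{T_0}=\{v\in V(G): v_{\mathrm{in}}$ belongs to some important $\{s\}-\{t'\}$ separator of size at most $2k$ in $G'_{T_0}\}$. *)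

(* Defs.v *)
From mathcomp Require Import all_boot.
Set Implicit Arguments.
Unset Strict Implicit.
Unset Printing Implicit Defensive.

(* A finite digraph H is a finite type of vertices with a set of edges
   E : {set V * V}; loops and antiparallel edges are allowed. *)

Section Digraph.
Variable V : finType.
Implicit Types (E S : {set V * V}) (A B W T : {set V}).

Definition edge E : rel V := [rel u v | (u, v) \in E].

(* The edges of H \ W; its vertices are those of ~: W. *)
Definition del E W : {set V * V} :=
  [set e in E | (e.1 \notin W) && (e.2 \notin W)].

(* R^+_{H \ W}(A). *)
Definition reach E W A : {set V} :=
  [set y | [exists x in A :\: W, connect (edge (del E W)) x y]].

Definition separator E A B W : bool :=
  [&& A != set0, B != set0, [disjoint A & B],
      W \subset ~: (A :|: B)
    & [forall a in A, forall b in B, ~~ connect (edge (del E W)) a b]].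

Definition minimal_separator E A B W : bool :=
  separator E A B W
    && [forall W' : {set V}, (W' \proper W) ==> ~~ separator E A B W'].

Definition important_separator E A B W : bool :=
  minimal_separator E A B W
    && ~~ [exists W' : {set V},
             [&& separator E A B W', #|W'| <= #|W|
               & reach E W A \proper reach E W' A]].

(* The closed walk is x :: p, with p the vertices after the initial one x;
   vertices and edges may repeat.  [pairmap pair x p] lists its edges. *)
Definition has_S_closed_walk E S : Prop :=
  exists (x : V) (p : seq V),
    [/\ path (edge E) x p, last x p = x
      & has (fun e => e \in S) (pairmap pair x p)].

Definition instance E S T (k : nat) : Prop :=
  [/\ S \subset E, 0 < k & ~ has_S_closed_walk (del E T) S].

Definition solution E S T (k : nat) (T' : {set V}) : Prop :=
  [/\ #|T'| <= k, [disjoint T' & T] & ~ has_S_closed_walk (del E T') S].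

Definition forward_shadow E T (T' : {set V}) : {set V} :=
  [set v | separator E T [set v] T'].

Definition reverse_shadow E T (T' : {set V}) : {set V} :=
  [set v | separator E [set v] T T'].

Definition shadowless E T (T' : {set V}) : Prop :=
  forward_shadow E T T' = set0 /\ reverse_shadow E T T' = set0.

End Digraph.

Section Constructions.
Variable V : finType.
Implicit Types (E S : {set V * V}) (T : {set V}).

Definition Sminus S : {set V} := [set e.1 | e in S].

(* G^+ has vertex type [option V]; the new vertex t is None. *)
Definition Gplus E S : {set option V * option V} :=
  [set (Some e.1, Some e.2) | e in E] :|: [set (Some u, None) | u in Sminus S].

Definition split_vertex : finType := (V + V + bool)%type.
Definition vin (v : V) : split_vertex := inl (inl v).
Definition vout (v : V) : split_vertex := inl (inr v).
Definition src : split_vertex := inr false.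
Definition snk : split_vertex := inr true.

(* G'_{T0}, with s = src and t' = snk. *)
Definition Gsplit E S (T0 : {set V}) : {set split_vertex * split_vertex} :=
  [set (vout e.1, if e \in S then vin e.2 else vout e.2) | e in E]
  :|: [set (vin v, vout v) | v : V]
  :|: [set (vin v, snk) | v : V]
  :|: [set (src, vout v) | v in T0].

Definition F_ E S (k : nat) (T0 : {set V}) : {set V} :=
  [set v | [exists W : {set split_vertex},
     [&& important_separator (Gsplit E S T0) [set src] [set snk] W,
         #|W| <= 2 * k & vin v \in W]]].

Definition F E S T (k : nat) : {set V} :=
  \bigcup_(T0 : {set V} | (T0 != set0) && (T0 \subset T)) F_ E S k T0.

End Constructions.

(* Main.v *)
Require Import Defs.
From mathcomp Require Import all_boot.
Set Implicit Arguments.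
Unset Strict Implicit.
Unset Printing Implicit Defensive.

(** Let [T1] be a shadowless solution, and let [C] be the last strongly connected
    component of [G \ T1] among those meeting [T]: as every vertex outside [T1]
    reaches [T], nothing but [T1] can be entered when leaving [C], and no edge of
    [S] lies inside [C].  Put [T0 = T :&: C].

    If an edge [(u, v)] of [S] leaves [C], then [v] is in [T1], and the in- and
    out-copies of [T1] form an [s - t'] separator of size at most [2k] which
    leaves [u_out] reachable.  An important separator reaching at least as far
    must contain [v_in], so [v] is in [F].

    Otherwise [T1] separates [T0] from [t] and [T \ T0] in [G^+].  Replace a
    minimal separator [W0] contained in [T1] by an important separator [W] that
    is no larger and reaches at least as far.  An [S]-closed walk created by this
    exchange would meet [W0 \ W], which is reachable from [T0] in [G^+ \ W];
    so the tail of its [S]-edge, and hence [t], would be reachable too. *)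

(** * Reachability after vertex deletion, separators and important separators *)

Section Separators.
Variable V : finType.
Implicit Types (E S : {set V * V}) (A B W R : {set V}).

Lemma edge_del E W x y :
  edge (del E W) x y = [&& (x, y) \in E, x \notin W & y \notin W].
Proof. by rewrite /edge /del /= inE. Qed.

(** Deleted vertices remain in the type as isolated points, so a walk from or to one of them is
    trivial; hence an equality of memberships. *)
Lemma connect_del_notin E W x y :
  connect (edge (del E W)) x y -> (x \in W) = (y \in W).
Proof.
case/connectP=> p; elim: p x => [|z p IHp] x /=; first by move=> _ ->.
case/andP; rewrite edge_del => /and3P[_ /negbTE-> /negbTE zW] /IHp{}IHp /IHp.
by rewrite zW.
Qed.

Lemma sub_reach E W A : [disjoint A & W] -> A \subset reach E W A.
Proof.
move=> dAW; apply/subsetP=> a aA; rewrite inE; apply/existsP; exists a.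
by rewrite inE aA (disjointFr dAW aA) connect0.
Qed.

Lemma reach_notin E W A x : x \in reach E W A -> x \notin W.
Proof.
rewrite inE => /existsP[a /andP[]]; rewrite inE => /andP[aW _].
by move/connect_del_notin <-.
Qed.

Lemma reach_connect E W A x y :
  x \in reach E W A -> connect (edge (del E W)) x y -> y \in reach E W A.
Proof.
rewrite !inE => /existsP[a /andP[aA ax]] xy; apply/existsP; exists a.
by rewrite aA (connect_trans ax xy).
Qed.

Lemma reach_edge E W A x y :
  x \in reach E W A -> (x, y) \in E -> y \notin W -> y \in reach E W A.
Proof.
move=> xR xy yW; apply: (reach_connect xR); apply: connect1.
by rewrite edge_del xy yW (reach_notin xR).
Qed.

Lemma reach_min E W A R :
    A :\: W \subset R ->
    (forall x y, x \in R -> (x, y) \in E -> x \notin W -> y \notin W -> y \in R) ->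
  reach E W A \subset R.
Proof.
move=> sAR closedR; apply/subsetP=> y; rewrite inE => /existsP[a /andP[aA]].
case/connectP=> p; have:= subsetP sAR a aA.
elim: p a {aA} => [|z p IHp] a aR /=; first by move=> _ ->.
by case/andP; rewrite edge_del => /and3P[az aW zW]; apply/IHp/(closedR a).
Qed.

Lemma reachS E W W' A : W' \subset W -> reach E W A \subset reach E W' A.
Proof.
move=> sW; have notinS x : x \notin W -> x \notin W' by apply/contra/subsetP.
apply: reach_min => [|x y xR xy _ yW]; last exact: reach_edge xR xy (notinS _ yW).
apply/subsetP=> a; rewrite !inE => /andP[aW aA]; apply/existsP; exists a.
by rewrite inE aA notinS // connect0.
Qed.

(** Since [W] avoids [A], no start vertex is lost in [A :\: W], and the condition on pairs becomes a
    single disjointness. *)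
Lemma separatorE E A B W :
  separator E A B W = [&& A != set0, B != set0, [disjoint A & B],
    W \subset ~: (A :|: B) & [disjoint reach E W A & B]].
Proof.
rewrite /separator; congr [&& _, _, _ & _].
case: (boolP (W \subset _)) => //= sW.
have aW a : a \in A -> a \notin W.
  by apply: contraL => /(subsetP sW); rewrite !inE negb_or => /andP[].
apply/forall_inP/pred0P => [sepW b | dRB a aA].
  rewrite /= inE; apply/negP => /andP[/existsP[a /andP[]]].
  by rewrite inE => /andP[_ /sepW/forall_inP sepa] ab /sepa/negP.
apply/forall_inP=> b bB; apply/negP=> ab; have:= dRB b.
rewrite /= bB andbT inE => /negbT/existsP[]; exists a.
by rewrite inE aW ?aA.
Qed.

Lemma separator_disjoint_reach E A B W :
  separator E A B W -> [disjoint reach E W A & B].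
Proof. by rewrite separatorE => /and5P[]. Qed.

Lemma separator_disjoint E A B W :
  separator E A B W -> [disjoint W & A :|: B].
Proof. by rewrite separatorE -disjoints_subset => /and5P[]. Qed.

Lemma separator_sub_reach E A B W :
  separator E A B W -> A \subset reach E W A.
Proof.
move/separator_disjoint; rewrite disjoint_sym => dW.
exact/sub_reach/(disjointWl _ dW)/subsetUl.
Qed.

(** A certificate for separation: a set [R] around [A] that cannot be left without entering [W]
    contains everything reachable from [A]. *)
Lemma separator_of_closed E A B W R :
    A != set0 -> B != set0 -> [disjoint W & A :|: B] -> A \subset R ->
    [disjoint R & B] ->
    (forall x y, x \in R -> (x, y) \in E -> x \notin W -> y \notin W -> y \in R) ->
  separator E A B W.
Proof.
move=> A0 B0 dW sAR dRB closedR; rewrite separatorE A0 B0 -disjoints_subset dW.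
rewrite (disjointWl sAR dRB) /=; apply: disjointWl dRB.
exact/reach_min/closedR/(subset_trans _ sAR)/subsetDl.
Qed.

Lemma minimal_separator_exists E A B W :
  separator E A B W -> exists2 W0, minimal_separator E A B W0 & W0 \subset W.
Proof.
case/minset_exists=> W0 /minsetP[sepW0 minW0] sW0; exists W0 => //.
rewrite /minimal_separator sepW0; apply/forallP=> W'; apply/implyP=> ltW'.
apply/negP=> /minW0/(_ (proper_sub ltW')) eqW.
by rewrite eqW properxx in ltW'.
Qed.

(** Without such a [u], the reachable set would stay closed when [w] is given back, so [W :\ w]
    would still separate, against minimality. *)
Lemma minimal_separator_pred E A B W w :
    minimal_separator E A B W -> w \in W ->
  exists2 u, u \in reach E W A & (u, w) \in E.
Proof.
case/andP=> sepW /forallP/(_ (W :\ w)) /implyP minW wW.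
apply/exists_inP; apply: contraT => /exists_inPn noP.
have /negP[] := minW (properD1 wW).
have [A0 B0 _ _ _] := and5P sepW.
apply: (separator_of_closed A0 B0 _ (separator_sub_reach sepW)).
- exact: disjointWl (subD1set _ _) (separator_disjoint sepW).
- exact: separator_disjoint_reach.
move=> x y xR xy _; rewrite in_setD1 negb_and negbK => /orP[/eqP yw | yW].
  by have:= noP x xR; rewrite -yw xy.
exact: reach_edge xR xy yW.
Qed.

(** Among the separators competing with [W], take [W1] of largest reach and shrink it to a minimal
    [W2]. Shrinking only enlarges the reach, so a [W3] beating [W2] would also beat [W1]. *)
Lemma important_separator_dominating E A B W :
    separator E A B W ->
  exists W', [/\ important_separator E A B W', #|W'| <= #|W|
                 & reach E W A \subset reach E W' A].
Proof.
move=> sepW.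
pose P W' := [&& separator E A B W', #|W'| <= #|W| & reach E W A \subset reach E W' A].
have PW : P W by rewrite /P sepW leqnn subxx.
case: (arg_maxnP (fun W' => #|reach E W' A|) PW) => W1 /and3P[sep1 le1 sR1] max1.
have [W2 min2 s21] := minimal_separator_exists sep1.
have le2 : #|W2| <= #|W| := leq_trans (subset_leq_card s21) le1.
have sR12 := reachS E A s21; have sR2 := subset_trans sR1 sR12.
exists W2; split=> //; rewrite /important_separator min2.
apply/existsP=> -[W3 /and3P[sep3 le3 ltR]].
have /max1 : P W3.
  by rewrite /P sep3 (leq_trans le3 le2) (subset_trans sR2 (proper_sub ltR)).
by rewrite /= leqNgt (leq_ltn_trans (subset_leq_card sR12) (proper_card ltR)).
Qed.

(** * Closed walks through [S], and terminal components *)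

Lemma S_closed_walkP E S :
  has_S_closed_walk E S <->
  exists u v, [/\ (u, v) \in S, (u, v) \in E & connect (edge E) v u].
Proof.
split=> [[x [p [xp px Sp]]] | [u [v [uvS uvE /connectP[p vp pu]]]]]; last first.
  by exists u, (v :: p); split; rewrite //= ?uvS //; apply/andP; split.
(* The endpoint is freed from being [x], so that the induction on [p] can run over open walks. *)
suff [u [v [uvS uvE xu vp]]] : exists u v, [/\ (u, v) \in S, (u, v) \in E,
    connect (edge E) x u & connect (edge E) v (last x p)].
  by exists u, v; split=> //; apply: connect_trans vp _; rewrite px.
elim: p x xp Sp {px} => //= y p IHp x /andP[xy yp] /orP[xyS | Sp].
  by exists x, y; split=> //; apply/connectP; exists p.
have [u [v [uvS uvE yu vp]]] := IHp y yp Sp.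
by exists u, v; split=> //; apply: connect_trans yu; apply: connect1.
Qed.

Lemma terminal_component E (T T' : {set V}) :
    T != set0 -> [disjoint T' & T] -> reverse_shadow E T T' = set0 ->
  exists C : {set V},
    [/\ T :&: C != set0, [disjoint C & T'],
        forall x y, x \in C -> (x, y) \in E -> y \notin T' -> y \in C
      & {in C &, forall x y, connect (edge (del E T')) x y}].
Proof.
move=> T0 dT shT; pose G := edge (del E T'); have /set0Pn[t tT] := T0.
(* A vertex of T whose reachable set is smallest lies in a terminal component. *)
case: (arg_minnP (fun t => #|[set y | connect G t y]|) tT) => {tT}t tT mint.
have {}tT : t \in T := tT; have tT' := disjointFl dT tT.
have backT x : x \in T -> connect G t x -> connect G x t.
  move=> xT tx; suff: t \in [set y | connect G x y] by rewrite inE.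
  suff /eqP-> : [set y | connect G x y] == [set y | connect G t y].
    by rewrite inE connect0.
  rewrite eqEcard mint // andbT; apply/subsetP=> y; rewrite !inE.
  exact: connect_trans.
have notinT' x : connect G t x -> x \notin T'.
  by move/connect_del_notin <-; rewrite tT'.
have back x : connect G t x -> connect G x t.
  move=> tx; case: (boolP (x \in T)) => [xT | xT]; first exact: backT.
  (* Otherwise [x] could not reach [T] once [T'] is deleted, and would lie in the empty reverse
     shadow. *)
  have /exists_inP[y yT xy] : [exists y in T, connect G x y].
    apply: contraT => /exists_inPn noy.
    suff : x \in reverse_shadow E T T' by rewrite shT inE.
    rewrite inE /separator T0 disjoints1 xT -disjoints_subset /=; apply/and3P; split.
    - by apply/set0Pn; exists x; rewrite inE.
    - rewrite disjoint_sym; apply/pred0P=> y /=; rewrite !inE; apply/negP.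
      case/andP=> /orP[/eqP-> | yT]; first exact/negP/notinT'.
      by rewrite (disjointFl dT yT).
    - by apply/forall_inP=> _ /set1P->; apply/forall_inP.
  exact: connect_trans xy (backT y yT (connect_trans tx xy)).
exists [set y | connect G t y]; split.
- by apply/set0Pn; exists t; rewrite !inE tT connect0.
- by apply/pred0P=> x /=; rewrite inE; case: (boolP (connect _ _ _)) => // /notinT'/negbTE.
- move=> x y; rewrite !inE => tx xy yT'; apply/(connect_trans tx)/connect1.
  by rewrite /G edge_del xy yT' notinT'.
- by move=> x y; rewrite !inE => /back xt; apply: connect_trans.
Qed.

End Separators.

(** * Exchanging separators in [Gplus] *)

Section Constructions.
Variable V : finType.
Implicit Types (E S : {set V * V}) (A B W : {set option V}) (T C : {set V}).

Lemma Gplus_Some E S x y : ((Some x, Some y) \in Gplus E S) = ((x, y) \in E).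
Proof.
rewrite inE; apply/orP/idP=> [[/imsetP[[a b] abE [-> ->]] | /imsetP[]] | xyE] //.
by left; apply/imsetP; exists (x, y).
Qed.

Lemma Gplus_None E S x : ((Some x, None) \in Gplus E S) = (x \in Sminus S).
Proof.
rewrite inE; apply/orP/idP=> [[/imsetP[] | /imsetP[y yS [->]]] | xS] //.
by right; apply: imset_f.
Qed.

(** Of [A] and [B] it matters that they cover [T] and that [None] is in [B]: this keeps [W] off [T]
    and off the new vertex. *)
Lemma solution_exchange E S T k (T' : {set V}) A B W0 W :
    solution E S T k T' ->
    None \in B -> Some @: T \subset A :|: B ->
    minimal_separator (Gplus E S) A B W0 -> W0 \subset Some @: T' ->
    separator (Gplus E S) A B W -> #|W| <= #|W0| ->
    reach (Gplus E S) W0 A \subset reach (Gplus E S) W A ->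
  solution E S T k (T' :\: Some @^-1: W0 :|: Some @^-1: W).
Proof.
move=> [T'k dT' noT'] NB sT minW0 sW0 sepW leW sR.
have dW := separator_disjoint sepW.
have inT' x : Some x \in W0 -> x \in T'.
  by move/(subsetP sW0)/imsetP=> [y yT' [->]].
have sub_card W1 : None \notin W1 -> #|Some @^-1: W1| = #|W1|.
  move=> NW1; rewrite -(card_imset _ Some_inj); apply: eq_card => -[x|].
    apply/imsetP/idP => [[y + [->]] | xW]; first by rewrite inE.
    by exists x; rewrite ?inE.
  by rewrite (negbTE NW1); apply/negP=> /imsetP[].
split.
- rewrite (leq_trans (leq_card_setU _ _).1) // sub_card; last first.
    by rewrite (disjointFl dW) // inE NB orbT.
  apply: leq_trans T'k; rewrite cardsD; move: leW.
  (* All of [W0] comes from [T'], so exactly [#|W0|] vertices are given up for the at most [#|W0|]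
     vertices of [W]. *)
  have -> : #|W0| = #|T' :&: Some @^-1: W0|.
    rewrite -sub_card; last by apply/negP => /(subsetP sW0)/imsetP[].
    apply: eq_card=> x; rewrite !inE; apply/idP/andP=> [xW|[]//].
    by rewrite inT'.
  have:= subset_leq_card (subsetIl T' (Some @^-1: W0)).
  by move=> le1 le2; rewrite -(subnK le1) addnK leq_add2l.
- apply/pred0P=> x /=; rewrite !inE; apply/negP=> /andP[/orP[/andP[_ xT'] | xW] xT].
    by rewrite (disjointFr dT' xT') in xT.
  by have:= subsetP sT _ (imset_f Some xT); rewrite (disjointFr dW xW).
set T'' := _ :|: _; case/S_closed_walkP=> u [v [uvS uvD vu]].
have := uvD; rewrite [(u, v) \in _]edge_del => /and3P[uvE uT'' vT''].
(* As a tail of an [S]-edge, [u] has an edge to [None], which lies in [B] and must not be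
   reached. *)
have uR : Some u \notin reach (Gplus E S) W A.
  apply/negP=> uR; have /negP[] := negbT (disjointFl (separator_disjoint_reach sepW) NB).
  apply: (reach_edge uR); first by rewrite Gplus_None; apply/imsetP; exists (u, v).
  by rewrite (disjointFl dW) // inE NB orbT.
have avoidR x : connect (edge (del E T'')) x u -> Some x \notin reach (Gplus E S) W A.
  case/connectP=> p; elim: p x => [|y p IHp] x /=; first by move=> _ <-.
  case/andP; rewrite edge_del => /and3P[xy _ yT''] yp pu.
  apply: contra (IHp y yp pu) => xR; apply: (reach_edge xR); rewrite ?Gplus_Some //.
  by apply: contra yT'' => yW; rewrite !inE yW orbT.
(* A vertex of [T'] that survives [T''] lies in [W0] but not in [W]. By minimality of [W0] it has an
   in-neighbour reached under [W0], hence under [W], so it would be reached itself. *)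
have avoidT' x : connect (edge (del E T'')) x u -> x \notin T'.
  move=> xu; have: x \notin T'' by rewrite (connect_del_notin xu).
  rewrite !inE negb_or negb_and negbK => /andP[/orP[xW0 xW|->//]].
  have [y yR yx] := minimal_separator_pred minW0 xW0.
  by have /negP[] := avoidR x xu; apply: reach_edge (subsetP sR _ yR) yx xW.
(* Every vertex of the walk leads to [u], so the walk avoids [T'] altogether and survives in
   [del E T']. *)
apply: noT'; apply/S_closed_walkP; exists u, v; split=> //.
  by rewrite [(u, v) \in _]edge_del uvE !avoidT' ?connect0.
case/connectP: vu => p; elim: p v {uvS uvD uvE vT''} => [|y p IHp] v /=.
  by move=> _ ->.
case/andP=> vy yp pu; have yu : connect (edge (del E T'')) y u by apply/connectP; exists p.
apply: connect_trans (IHp _ yp pu); apply: connect1; rewrite edge_del.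
have vu := connect_trans (connect1 vy) yu.
by move: vy; rewrite !edge_del !avoidT' // => /and3P[->].
Qed.

(** * The split digraph and membership in [F_] *)

Lemma Gsplit_S E S T x y :
  S \subset E -> (x, y) \in S -> (vout x, vin y) \in Gsplit E S T.
Proof.
move=> sSE xyS; rewrite !inE -!orbA; apply/or4P/Or41/imsetP; exists (x, y).
  exact: (subsetP sSE).
by rewrite xyS.
Qed.

Lemma Gsplit_nS E S T x y :
  (x, y) \in E -> (x, y) \notin S -> (vout x, vout y) \in Gsplit E S T.
Proof.
move=> xyE xyS; rewrite !inE -!orbA; apply/or4P/Or41/imsetP; exists (x, y) => //.
by rewrite (negbTE xyS).
Qed.

Lemma Gsplit_snk E S T x : (vin x, snk V) \in Gsplit E S T.
Proof. by rewrite !inE -!orbA; apply/or4P/Or43/imset_f. Qed.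

Lemma Gsplit_src E S T y : ((src V, y) \in Gsplit E S T) = (y \in @vout V @: T).
Proof.
rewrite !inE -!orbA; apply/or4P/imsetP => [[] /imsetP[x] // xT [->] | [x xT ->]].
  by exists x.
by apply/Or44/imsetP; exists x.
Qed.

Lemma Gsplit_vout E S T x y :
    (vout x, y) \in Gsplit E S T ->
  exists2 z, (x, z) \in E & y = if (x, z) \in S then vin z else vout z.
Proof.
by rewrite !inE -!orbA => /or4P[] /imsetP[] // [a b] abE [-> ->]; exists b.
Qed.

Lemma F_terminal_component E S T k (T' : {set V}) C u v :
    S \subset E -> #|T'| <= k -> [disjoint C & T'] -> T :&: C != set0 ->
    (forall x y, x \in C -> (x, y) \in E -> y \notin T' -> y \in C) ->
    {in C &, forall x y, connect (edge (del E T')) x y} ->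
    (forall x y, x \in C -> y \in C -> (x, y) \notin S) ->
    u \in C -> (u, v) \in S ->
  v \in F_ E S k (T :&: C).
Proof.
move=> sSE T'k dC TC0 closedC connC noS uC uvS.
set H := Gsplit E S (T :&: C).
pose W : {set split_vertex V} := @vin V @: T' :|: @vout V @: T'.
have vin_inj : injective (@vin V) by move=> x y [].
have vout_inj : injective (@vout V) by move=> x y [].
have vinW x : (vin x \in W) = (x \in T').
  by rewrite inE mem_imset // orbC; case: imsetP => // -[].
have voutW x : (vout x \in W) = (x \in T').
  by rewrite inE [X in _ || X]mem_imset //; case: imsetP => // -[].
have Wk : #|W| <= 2 * k.
  rewrite (leq_trans (leq_card_setU _ _).1) // !card_imset // addnn -mul2n.
  by rewrite leq_mul2l.
have sepW : separator H [set src V] [set snk V] W.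
  (* The out-copies of [C] certify separation: an edge of [E] leaving [C] enters [T'], and no edge
     inside [C] is in [S], so no in-copy outside [W] is entered. *)
  apply: (@separator_of_closed _ _ _ _ _ (src V |: @vout V @: C)).
  - by apply/set0Pn; exists (src V); rewrite inE.
  - by apply/set0Pn; exists (snk V); rewrite inE.
  - apply/pred0P=> x /=; rewrite !inE; apply/negP.
    by case/andP=> /orP[] /imsetP[y _ ->].
  - exact: subsetUl.
  - apply/pred0P=> x /=; rewrite !inE; apply/negP.
    by case/andP=> /orP[/eqP-> | /imsetP[y _ ->]].
  move=> x y; case/setU1P=> [-> | /imsetP[a aC ->]].
    rewrite Gsplit_src => /imsetP[b]; rewrite inE => /andP[_ bC] -> _ _.
    by rewrite inE mem_imset // bC orbT.
  case/Gsplit_vout=> b ab -> _; case: ifP => abS.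
    rewrite vinW => /(closedC a b aC ab) bC.
    by have:= noS a b aC bC; rewrite abS.
  by rewrite voutW => /(closedC a b aC ab) bC; rewrite inE mem_imset // bC orbT.
have [W' [impW' leW' sR]] := important_separator_dominating sepW.
have /andP[/andP[sepW' _] _] := impW'.
rewrite inE; apply/existsP; exists W'; rewrite impW' (leq_trans leW' Wk) /=.
(* A walk inside [C] from a vertex of [T :&: C] to [u] uses no edge of [S], so it lifts to
   out-copies avoiding [W]. *)
have uR : vout u \in reach H W [set src V].
  have /set0Pn[t /setIP[tT tC]] := TC0.
  have tR : vout t \in reach H W [set src V].
    apply: (@reach_edge _ _ _ _ (src V)).
    - by apply: (subsetP (separator_sub_reach sepW)); rewrite inE.
    - by rewrite Gsplit_src; apply: imset_f; rewrite inE tT.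
    by rewrite voutW (disjointFr dC tC).
  have /connectP[p] := connC t u tC uC.
  elim: p t tC tR {tT} => [|z p IHp] t tC tR /=; first by move=> _ ->.
  case/andP; rewrite edge_del => /and3P[tz _ zT'].
  have zC := closedC t z tC tz zT'; apply: IHp => //.
  by apply: (reach_edge tR); rewrite ?voutW // Gsplit_nS ?noS.
(* If [vin v] were outside [W'], it would be reached through the [S]-edge from [vout u], and the
   sink right after it. *)
apply: contraT => vW'.
have vR := reach_edge (subsetP sR _ uR) (Gsplit_S (T :&: C) sSE uvS) vW'.
have snkW' : snk V \notin W'.
  by rewrite (disjointFl (separator_disjoint sepW')) // !inE eqxx orbT.
have := reach_edge vR (Gsplit_snk E S _ v) snkW'.
by rewrite (disjointFl (separator_disjoint_reach sepW')) // inE.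
Qed.

End Constructions.

(** * The two cases for the terminal component *)

Theorem theorem9 (V : finType) (E S : {set V * V}) (T : {set V}) (k : nat)
    (hinst : instance E S T k)
    (hT : T != set0)
    (hsl : exists T1 : {set V}, solution E S T k T1 /\ shadowless E T T1) :
  exists T' : {set V},
    solution E S T k T' /\
    ((exists v : V, v \in T' /\ v \in F E S T k :\: T) \/
     (exists (T0 : {set V}) (W : {set option V}),
        [/\ T0 != set0, T0 \subset T,
            important_separator (Gplus E S)
              [set Some v | v in T0]
              (None |: [set Some v | v in T :\: T0]) W
          & W \subset [set Some v | v in T']])).
Proof.
have [sSE _ _] := hinst; have [T1 [solT1 [_ shT1]]] := hsl.
have [T1k dT1 noT1] := solT1.
have [C [TC0 dC closedC connC]] := terminal_component hT dT1 shT1.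
(* An edge of [S] inside [C] would be closed up by a walk avoiding [T1], by strong connectivity. *)
have noS x y : x \in C -> y \in C -> (x, y) \notin S.
  move=> xC yC; apply/negP=> xyS; apply: noT1; apply/S_closed_walkP.
  exists x, y; split=> //; last exact: connC.
  by rewrite [(x, y) \in _]edge_del (subsetP sSE) // !(disjointFr dC).
(* By [noS], an edge of [S] with its tail in [C] is one that leaves [C]. *)
have [/existsP[u /andP[uC /imsetP[[u' v] uvS /= eqU]]] | noSC] :=
    boolP [exists u, (u \in C) && (u \in Sminus S)].
  subst u'; have vT1 : v \in T1.
    apply: contraT => vT1; have vC := closedC u v uC (subsetP sSE _ uvS) vT1.
    by have:= noS u v uC vC; rewrite uvS.
  exists T1; split=> //; left; exists v; split=> //.
  rewrite inE (disjointFr dT1 vT1); apply/bigcupP; exists (T :&: C).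
    by rewrite TC0 subsetIl.
  exact: F_terminal_component sSE T1k dC TC0 closedC connC noS uC uvS.
set T0 := T :&: C; set A := [set Some v | v in T0].
set B := None |: [set Some v | v in T :\: T0].
have sT : Some @: T \subset A :|: B.
  apply/subsetP=> _ /imsetP[x xT ->]; rewrite !inE !(mem_imset _ _ Some_inj).
  by rewrite !inE xT andbT orbN.
have sepT1 : separator (Gplus E S) A B (Some @: T1).
  (* No tail of an [S]-edge lies in [C] in this case, so no edge leads from [Some @: C] to
     [None]. *)
  apply: (@separator_of_closed _ _ _ _ _ (Some @: C)).
  - by rewrite imset_eq0.
  - by apply/set0Pn; exists None; rewrite !inE.
  - apply/pred0P=> x /=; apply/negP=> /andP[/imsetP[y yT1 ->]].
    rewrite !inE !(mem_imset _ _ Some_inj) !inE.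
    by rewrite (disjointFr dT1 yT1) andbF.
  - exact/imsetS/subsetIr.
  - apply/pred0P=> x /=; apply/negP=> /andP[/imsetP[y yC ->]].
    rewrite !inE !(mem_imset _ _ Some_inj) !inE yC.
    by rewrite andbT andNb.
  move=> _ y /imsetP[x xC ->]; case: y => [y|].
    rewrite Gplus_Some !(mem_imset _ _ Some_inj) => xy _.
    exact: closedC xC xy.
  rewrite Gplus_None => xS; have /negP[] := noSC.
  by apply/existsP; exists x; rewrite xC.
have [W0 minW0 sW0] := minimal_separator_exists sepT1.
have /andP[sepW0 _] := minW0.
have [W [impW leW sR]] := important_separator_dominating sepW0.
have /andP[/andP[sepW _] _] := impW.
exists (T1 :\: Some @^-1: W0 :|: Some @^-1: W); split.
  apply: solution_exchange solT1 _ sT minW0 sW0 sepW leW sR.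
  by rewrite !inE.
right; exists T0, W; split=> //; first exact: subsetIl.
(* [None] is in [B], so [W] consists of vertices of the original digraph, all of them put into the
   new solution. *)
apply/subsetP=> -[x xW | NW]; first by apply: imset_f; rewrite !inE xW orbT.
by have:= disjointFr (separator_disjoint sepW) NW; rewrite !inE orbT.
Qed.
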